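(* Let $\mathcal M$ be a $\mathrm{B}^{\mathrm{PN}}$-matrix over $\Sigma$ and let $\Theta$ be a discriminator for $\mathcal M$, with $S_\Theta=\bigcup_{x\in V}(\Theta^x_{\mathsf A}\cup\Theta^x_{\overline{\mathsf A}}\cup\Theta^x_{\mathsf R}\cup\Theta^x_{\overline{\mathsf R}})$. Then the calculus $\mathcal R_{\mathcal M,\Theta}$ is complete with respect to $\mathcal M$ (every B-statement holding in $\mathcal M$ is provable in $\mathcal R_{\mathcal M,\Theta}$). Furthermore, $\mathcal R_{\mathcal M,\Theta}$ is $S_\Theta$-analytic.
   Context: Formulas $L_\Sigma$ over a signature $\Sigma=(\Sigma_k)_k$ and a denumerable set $P$ of variables; substitutions are endomorphisms; $\mathrm{sub}$ gives subformulas; for a set $\Theta$ of formulas in the single variable $p$, $\Theta(\varphi)=\{\psi(\varphi):\psi\in\Theta\}$. A B-statement is a quadruple $\Phi=(\Phi_{\mathsf A},\Phi_{\overline{\mathsf A}},\Phi_{\mathsf R},\Phi_{\overline{\mathsf R}})$ of sets of formulas; $\mathrm{sub}(\Phi)=\bigcup_\alpha\mathrm{sub}(\Phi_\alpha)$. A $\mathrm{B}^{\mathrm{PN}}$-matrix is $\mathcal M=(V,D,D',\cdot^{\mathcal M})$ with $D,D'\subseteq V$ and $\copyright^{\mathcal M}:V^k\to\mathcal P(V)$ for $\copyright\in\Sigma_k$ (possibly empty outputs). $\mathcal D_{\mathsf A}=D$, $\mathcal D_{\overline{\mathsf A}}=V\setminus D$, $\mathcal D_{\mathsf R}=D'$,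 $\mathcal D_{\overline{\mathsf R}}=V\setminus D'$. An $\mathcal M$-valuation is $v:L_\Sigma\to V$ with $v(\copyright(\varphi_1,\dots,\varphi_k))\in\copyright^{\mathcal M}(v(\varphi_1),\dots,v(\varphi_k))$. $\Phi$ holds in $\mathcal M$ iff no $\mathcal M$-valuation $v$ satisfies $v(\Phi_\alpha)\subseteq\mathcal D_\alpha$ for all four $\alpha$. For single-variable $\psi$, $\psi^{\mathcal M}(x)=\{v(\psi):v(p)=x\}$. For nonempty $X\subseteq V$ the sub-matrix induced by $X$ has values $X$ and interpretations $\copyright^{\mathcal M}(\vec x)\cap X$ ($\vec x\in X^k$), total if none is empty; $\mathsf T(\mathcal M)=\bigcup\{\mathcal P(X):\emptyset\ne X\subseteq V\text{ with total induced sub-matrix}\}$. Discriminator: $X,Y\subseteq V$ are $\alpha$-separated ($\alpha\in\{\mathsf A,\mathsf R\}$) if $X\subseteq\mathcal D_\alpha, Y\subseteq V\setminus\mathcal D_\alpha$ or vice versa; single-variable $\psi$ is a monadic separator for $x,y$ if $\psi^{\mathcal M}(x),\psi^{\mathcal M}(y)$ are $\alpha$-separated for some $\alpha$; a set isolates $x$ if it contains a separator for $x,y$ for each $y\ne x$. A discriminator is a family $\big((\Theta^x_{\mathsf A},\Theta^x_{\overline{\mathsf A}},\Theta^x_{\mathsf R},\Theta^x_{\overline{\mathsf R}})\big)_{x\in V}$ of sets of formulas in the variable $p$ with $\bigcup_\alpha\Theta^x_\alpha$ isolating $x$ and $\psi^{\mathcal M}(x)\subseteq\mathcal D_\alpha$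 whenever $\psi\in\Theta^x_\alpha$. Proofs: a rule schema has antecedent $(\Delta_{\mathsf A},\Delta_{\mathsf R})$ and succedent $(\Delta_{\overline{\mathsf A}},\Delta_{\overline{\mathsf R}})$; instances arise by substitution; a calculus is a set of schemas. A derivation is a rooted tree (every branch ending in a leaf) with nodes labelled by pairs $(\Gamma_{\mathsf A},\Gamma_{\mathsf R})$ or by $\star$, each non-leaf node expanded by an instance of a rule of the calculus with $\Delta_{\mathsf A}\subseteq\Gamma_{\mathsf A}$, $\Delta_{\mathsf R}\subseteq\Gamma_{\mathsf R}$: if the succedent is empty its only child is labelled $\star$; otherwise its children are exactly nodes labelled $(\Gamma_{\mathsf A}\cup\{\psi\},\Gamma_{\mathsf R})$, $\psi\in\Delta_{\overline{\mathsf A}}$, and $(\Gamma_{\mathsf A},\Gamma_{\mathsf R}\cup\{\psi\})$, $\psi\in\Delta_{\overline{\mathsf R}}$. A proof of $\Phi$ is a derivation with root label $(\Gamma_{\mathsf A},\Gamma_{\mathsf R})$, $\Gamma_{\mathsf A}\subseteq\Phi_{\mathsf A}$, $\Gamma_{\mathsf R}\subseteq\Phi_{\mathsf R}$, each leaf labelled $\star$ or by $(\Gamma'_{\mathsf A},\Gamma'_{\mathsf R})$ with $\Gamma'_{\mathsf A}\cap\Phi_{\overline{\mathsf A}}\ne\emptyset$ or $\Gamma'_{\mathsf R}\cap\Phi_{\overline{\mathsf R}}\ne\emptyset$. For a set $\Lambda$ of formulas, $\mathrm{sub}^\Lambda(\Phi)=\mathrm{sub}(\Phi)\cup\{\sigma(\psi):\psi\in\Lambda,\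 \sigma(P)\subseteq\mathrm{sub}(\Phi)\}$; a proof is $\Lambda$-analytic if all non-$\star$ labels consist of formulas of $\mathrm{sub}^\Lambda(\Phi)$; a calculus is $\Lambda$-analytic if every B-statement provable in it has a $\Lambda$-analytic proof. The calculus $\mathcal R_{\mathcal M,\Theta}$: for $X\subseteq V$, a choice w.r.t. $(\mathsf A,\mathsf R)$ is a pair $(\hat\Theta^X_{\mathsf A},\hat\Theta^X_{\mathsf R})$ obtained by choosing for each $x\in X$ one formula of $\Theta^x_{\mathsf A}\cup\Theta^x_{\mathsf R}$, placed in $\hat\Theta^X_{\mathsf A}$ if chosen from $\Theta^x_{\mathsf A}$ and in $\hat\Theta^X_{\mathsf R}$ if from $\Theta^x_{\mathsf R}$; analogously $(\hat\Theta^X_{\overline{\mathsf A}},\hat\Theta^X_{\overline{\mathsf R}})$. $P_\beta(x)=\{p\}$ if $x\in\mathcal D_\beta$, else $\emptyset$. Rules: (∃) for $X\subseteq V$, $\bar X=V\setminus X$ and any such choices: antecedent $(\hat\Theta^X_{\overline{\mathsf A}},\hat\Theta^X_{\overline{\mathsf R}})$, succedent $(\hat\Theta^{\bar X}_{\mathsf A},\hat\Theta^{\bar X}_{\mathsf R})$. (D) for $x\in V$: antecedent $(\Theta^x_{\mathsf A}(p)\cup P_{\overline{\mathsf A}}(x),\Theta^x_{\mathsf R}(p))$, succedent $(\Theta^x_{\overline{\mathsf A}}(p)\cup P_{\mathsf A}(x),\Theta^x_{\overline{\mathsf R}}(p))$; and antecedent $(\Theta^x_{\mathsf A}(p),\Theta^x_{\mathsf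 R}(p)\cup P_{\overline{\mathsf R}}(x))$, succedent $(\Theta^x_{\overline{\mathsf A}}(p),\Theta^x_{\overline{\mathsf R}}(p)\cup P_{\mathsf R}(x))$. (Σ) for $\copyright\in\Sigma_k$, $(x_1,\dots,x_k)\in V^k$, $y\notin\copyright^{\mathcal M}(x_1,\dots,x_k)$, distinct $p_1,\dots,p_k$, with $S_\beta=\bigcup_i\Theta^{x_i}_\beta(p_i)\cup\Theta^y_\beta(\copyright(p_1,\dots,p_k))$: antecedent $(S_{\mathsf A},S_{\mathsf R})$, succedent $(S_{\overline{\mathsf A}},S_{\overline{\mathsf R}})$. (T) for $X\notin\mathsf T(\mathcal M)$ and distinct variables $(p_x)_{x\in X}$: antecedent $(\bigcup_x\Theta^x_{\mathsf A}(p_x),\bigcup_x\Theta^x_{\mathsf R}(p_x))$, succedent $(\bigcup_x\Theta^x_{\overline{\mathsf A}}(p_x),\bigcup_x\Theta^x_{\overline{\mathsf R}}(p_x))$.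
   Formalization: Analyticity assumes each y≠x is separated from x by some ψ∈Θ^x_α with ψ^M(y) outside D_α, and that Σ is countable or distinct variables (p_x), x∈X, exist for all X∉T(M); derivation trees may have transfinite branches, with unions of labels at limit nodes. *)

(* Defs.v *)
From mathcomp Require Import all_boot.
From mathcomp Require Import all_classical.

Set Implicit Arguments.
Unset Strict Implicit.
Unset Printing Implicit Defensive.

Local Open Scope classical_set_scope.

(** * Formulas *)

(* The denumerable set of variables is [nat]. *)
Inductive formula (Sg : nat -> Type) : Type :=
| Var of nat
| App k of Sg k & ('I_k -> formula Sg).

Arguments Var {Sg} _.
Arguments App {Sg k} _ _.

(* The variable p of monadic formulas and of the one-variable rule schemas. *)
Notation pvar := 0%N.

(* The endomorphism of the formula algebra extending s. *)
Fixpoint subst (Sg : nat -> Type) (s : nat -> formula Sg) (phi : formula Sg) :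
    formula Sg :=
  match phi with
  | Var i => s i
  | App _ c args => App c (fun i => subst s (args i))
  end.

Fixpoint subf (Sg : nat -> Type) (phi : formula Sg) : set (formula Sg) :=
  match phi with
  | Var i => [set Var i]
  | App _ c args => [set App c args] `|` \bigcup_i subf (args i)
  end.

Definition single_var (Sg : nat -> Type) (psi : formula Sg) : Prop :=
  forall i, subf psi (Var i) -> i = pvar.

(* S(phi) = { psi(phi) : psi in S }; meaningful when S consists of formulas in
   the variable p. *)
Definition plug (Sg : nat -> Type) (S : set (formula Sg)) (phi : formula Sg) :
    set (formula Sg) :=
  [set subst (fun=> phi) psi | psi in S].

(** * B-statements and matrices *)

(* Acceptance and rejection. *)
Variant cog : Type := cA | cR.

(* The four attitudes: [Pl c] is c itself, [Ov c] is the overlined c. *)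
Variant att : Type := Pl of cog | Ov of cog.

Definition statement (Sg : nat -> Type) : Type := att -> set (formula Sg).

Definition sub_stmt (Sg : nat -> Type) (Phi : statement Sg) :
    set (formula Sg) :=
  [set phi | exists a, exists2 psi, Phi a psi & subf psi phi].

Record matrix (Sg : nat -> Type) : Type := Matrix {
  carrier :> Type;
  des : cog -> set carrier;   (* des cA = D, des cR = D' *)
  interp : forall k, Sg k -> ('I_k -> carrier) -> set carrier
}.

Arguments des {Sg} M c : rename.
Arguments interp {Sg} M {k} c xs : rename.

Definition dset (Sg : nat -> Type) (M : matrix Sg) (a : att) : set M :=
  match a with
  | Pl c => des M c
  | Ov c => ~` des M c
  end.

Arguments dset {Sg} M a _.

Definition valuation (Sg : nat -> Type) (M : matrix Sg)
    (v : formula Sg -> M) : Prop :=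
  forall k (c : Sg k) (args : 'I_k -> formula Sg),
    interp M c (fun i => v (args i)) (v (App c args)).

Definition holds (Sg : nat -> Type) (M : matrix Sg) (Phi : statement Sg) :
    Prop :=
  ~ exists2 v : formula Sg -> M,
      valuation v & forall a, v @` Phi a `<=` dset M a.

(* psi^M(x) *)
Definition values (Sg : nat -> Type) (M : matrix Sg) (psi : formula Sg)
    (x : M) : set M :=
  [set y | exists v : formula Sg -> M,
             [/\ valuation v, v (Var pvar) = x & v psi = y]].

Definition submatrix (Sg : nat -> Type) (M : matrix Sg) (X : set M) :
    matrix Sg :=
  @Matrix Sg {x : M | X x}
    (fun c => [set x | des M c (sval x)])
    (fun k c xs => [set y | interp M c (fun i => sval (xs i)) (sval y)]).

Definition total_mx (Sg : nat -> Type) (M : matrix Sg) : Prop :=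
  forall k (c : Sg k) (xs : 'I_k -> M), interp M c xs !=set0.

(* T(M) *)
Definition TT (Sg : nat -> Type) (M : matrix Sg) : set (set M) :=
  [set Y | exists X : set M,
             [/\ X !=set0, total_mx (submatrix X) & Y `<=` X]].

Arguments TT {Sg} M _.

(** * Discriminators *)

Definition separated (Sg : nat -> Type) (M : matrix Sg) (c : cog)
    (X Y : set M) : Prop :=
  (X `<=` des M c /\ Y `<=` ~` des M c) \/
  (Y `<=` des M c /\ X `<=` ~` des M c).

Definition separator (Sg : nat -> Type) (M : matrix Sg) (x y : M)
    (psi : formula Sg) : Prop :=
  single_var psi /\
  exists c, separated c (values psi x) (values psi y).

Definition isolates (Sg : nat -> Type) (M : matrix Sg) (S : set (formula Sg))
    (x : M) : Prop :=
  forall y : M, y <> x -> exists2 psi, S psi & separator x y psi.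

Definition discriminator (Sg : nat -> Type) (M : matrix Sg)
    (Theta : M -> statement Sg) : Prop :=
  forall x : M,
    [/\ forall a psi, Theta x a psi -> single_var psi,
        isolates (\bigcup_a Theta x a) x
      & forall a psi, Theta x a psi -> values psi x `<=` dset M a].

Definition formulas_of (Sg : nat -> Type) (M : matrix Sg)
    (Theta : M -> statement Sg) : set (formula Sg) :=
  \bigcup_x \bigcup_a Theta x a.

(* Every y <> x is told apart from x by some psi in Theta^x_a, and in the sense
   recorded by a: psi^M(x) is included in D_a (this is part of
   [discriminator]) and psi^M(y) in the complement of D_a.  [discriminator]
   alone does not ensure this: a formula listed in Theta^x_A may separate x
   from y only by its rejection values, or only because psi^M(x) is empty. *)
Definition oriented (Sg : nat -> Type) (M : matrix Sg)
    (Theta : M -> statement Sg) : Prop :=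
  forall x y : M, y <> x ->
    exists a, exists2 psi, Theta x a psi & values psi y `<=` ~` dset M a.

(** * Rules and derivations *)

(* A pair of sets of formulas, indexed by its A- and R-components. *)
Definition spair (Sg : nat -> Type) : Type := cog -> set (formula Sg).

Definition mkpair (Sg : nat -> Type) (S T : set (formula Sg)) : spair Sg :=
  fun c => match c with cA => S | cR => T end.

(* [ant] is (Delta_A, Delta_R); [suc] is (Delta_Abar, Delta_Rbar). *)
Record schema (Sg : nat -> Type) : Type := Schema {
  ant : spair Sg;
  suc : spair Sg
}.

Definition calculus (Sg : nat -> Type) : Type := set (schema Sg).

(* Adds phi to the c-component of G. *)
Definition extend (Sg : nat -> Type) (G : spair Sg) (c : cog)
    (phi : formula Sg) : spair Sg :=
  fun b => G b `|` [set psi | b = c /\ psi = phi].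

(* Nodes are labelled by pairs ([Some]) or by the star ([None]). *)
Record ltree (Sg : nat -> Type) : Type := LTree {
  node :> Type;
  tle : node -> node -> Prop;
  troot : node;
  label : node -> option (spair Sg)
}.

Definition tlt (Sg : nat -> Type) (t : ltree Sg) (m n : t) : Prop :=
  tle m n /\ m <> n.

Definition child (Sg : nat -> Type) (t : ltree Sg) (n m : t) : Prop :=
  tlt n m /\ ~ exists k : t, tlt n k /\ tlt k m.

Definition leaf (Sg : nat -> Type) (t : ltree Sg) (n : t) : Prop :=
  forall m : t, tle n m -> m = n.

(* A branch is a maximal chain. *)
Definition branch (Sg : nat -> Type) (t : ltree Sg) (C : set t) : Prop :=
  total_on C (@tle Sg t) /\
  forall C' : set t, total_on C' (@tle Sg t) -> C `<=` C' -> C' = C.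

(* Order-theoretic rooted trees: the ancestors of a node are well-ordered, but
   there may be infinitely many of them. Rules may have infinite antecedents,
   which are in general collected only along an infinite path. *)
Definition rooted_tree (Sg : nat -> Type) (t : ltree Sg) : Prop :=
  [/\ [/\ forall n : t, tle n n,
          forall m n : t, tle m n -> tle n m -> m = n
        & forall l m n : t, tle l m -> tle m n -> tle l n],
      forall n : t, tle (troot t) n,
      forall (n : t) (B : set t), B !=set0 -> (forall m, B m -> tlt m n) ->
        exists2 m, B m & forall m', B m' -> tle m m'
    & forall C : set t, branch C -> exists2 n, C n & leaf n].

(* The node n, labelled G, is expanded by the instance of r given by s. *)
Definition expanded_by (Sg : nat -> Type) (t : ltree Sg) (n : t)
    (G : spair Sg) (r : schema Sg) (s : nat -> formula Sg) : Prop :=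
  [/\ forall c, subst s @` ant r c `<=` G c,
      (forall c, suc r c = set0) ->
        exists m : t, label m = None /\ forall m', child n m' <-> m' = m
    & (exists c, suc r c !=set0) ->
        (forall c psi, suc r c psi ->
           exists2 m, child n m & label m = Some (extend G c (subst s psi)))
        /\
        (forall m, child n m ->
           exists c, exists2 psi, suc r c psi &
             label m = Some (extend G c (subst s psi)))].

(* The label of a node that is neither the root nor a child of any node is the
   union of the labels of its ancestors. *)
Definition derivation (Sg : nat -> Type) (Rc : calculus Sg) (t : ltree Sg) :
    Prop :=
  [/\ rooted_tree t,
      forall n : t, ~ leaf n ->
        exists G r s, [/\ label n = Some G, Rc r & expanded_by n G r s]
    & forall n : t, n <> troot t -> (forall m, ~ child m n) ->
        label n = Some (fun c => [set phi | exists m G,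
                          [/\ tlt m n, label m = Some G & G c phi]])].

Definition proof_of (Sg : nat -> Type) (Rc : calculus Sg)
    (Phi : statement Sg) (t : ltree Sg) : Prop :=
  [/\ derivation Rc t,
      exists2 G, label (troot t) = Some G & forall c, G c `<=` Phi (Pl c)
    & forall n : t, leaf n ->
        label n = None \/
        exists2 G, label n = Some G &
          exists c, G c `&` Phi (Ov c) !=set0].

Definition provable (Sg : nat -> Type) (Rc : calculus Sg)
    (Phi : statement Sg) : Prop :=
  exists t : ltree Sg, proof_of Rc Phi t.

Definition complete (Sg : nat -> Type) (Rc : calculus Sg) (M : matrix Sg) :
    Prop :=
  forall Phi : statement Sg, holds M Phi -> provable Rc Phi.

(* sub^Lambda(Phi) *)
Definition gsub (Sg : nat -> Type) (Lambda : set (formula Sg))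
    (Phi : statement Sg) : set (formula Sg) :=
  sub_stmt Phi `|`
  [set phi | exists s : nat -> formula Sg, exists psi,
     [/\ Lambda psi, forall i, sub_stmt Phi (s i) & phi = subst s psi]].

Definition analytic_tree (Sg : nat -> Type) (Lambda : set (formula Sg))
    (Phi : statement Sg) (t : ltree Sg) : Prop :=
  forall (n : t) (G : spair Sg), label n = Some G ->
    forall c, G c `<=` gsub Lambda Phi.

Definition analytic (Sg : nat -> Type) (Lambda : set (formula Sg))
    (Rc : calculus Sg) : Prop :=
  forall Phi : statement Sg, provable Rc Phi ->
    exists2 t : ltree Sg, proof_of Rc Phi t & analytic_tree Lambda Phi t.

(** * The calculus of a matrix and a discriminator *)

(* S is a choice for X with respect to (q cA, q cR): f picks for each x in X a
   formula together with the component it is chosen from. *)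
Definition choice_for (Sg : nat -> Type) (M : matrix Sg)
    (Theta : M -> statement Sg) (q : cog -> att) (X : set M)
    (S : spair Sg) : Prop :=
  exists f : M -> cog * formula Sg,
    (forall x, X x -> Theta x (q (f x).1) (f x).2) /\
    forall c, S c = [set psi | exists2 x, X x & f x = (c, psi)].

(* P_a(x) *)
Definition pset (Sg : nat -> Type) (M : matrix Sg) (a : att) (x : M) :
    set (formula Sg) :=
  [set psi | dset M a x /\ psi = Var pvar].

Inductive calc (Sg : nat -> Type) (M : matrix Sg)
    (Theta : M -> statement Sg) : calculus Sg :=
| rule_E (X : set M) (S T : spair Sg) of
    choice_for Theta Ov X S & choice_for Theta Pl (~` X) T :
    calc Theta (Schema S T)
| rule_DA (x : M) :
    calc Theta (Schema
      (mkpair (plug (Theta x (Pl cA)) (Var pvar) `|` pset (Ov cA) x)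
              (plug (Theta x (Pl cR)) (Var pvar)))
      (mkpair (plug (Theta x (Ov cA)) (Var pvar) `|` pset (Pl cA) x)
              (plug (Theta x (Ov cR)) (Var pvar))))
| rule_DR (x : M) :
    calc Theta (Schema
      (mkpair (plug (Theta x (Pl cA)) (Var pvar))
              (plug (Theta x (Pl cR)) (Var pvar) `|` pset (Ov cR) x))
      (mkpair (plug (Theta x (Ov cA)) (Var pvar))
              (plug (Theta x (Ov cR)) (Var pvar) `|` pset (Pl cR) x)))
| rule_Sg k (c : Sg k) (xs : 'I_k -> M) (y : M) (ps : 'I_k -> nat) of
    ~ interp M c xs y & injective ps :
    let S a := (\bigcup_i plug (Theta (xs i) a) (Var (ps i)))
               `|` plug (Theta y a) (App c (fun i => Var (ps i))) in
    calc Theta (Schema (fun b => S (Pl b)) (fun b => S (Ov b)))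
| rule_T (X : set M) (ps : M -> nat) of
    ~ TT M X & (forall x y, X x -> X y -> ps x = ps y -> x = y) :
    let S a := \bigcup_(x in X) plug (Theta x a) (Var (ps x)) in
    calc Theta (Schema (fun b => S (Pl b)) (fun b => S (Ov b))).

(* Distinct variables (p_x) for x in X, as used by the T-rules, exist for every
   X outside T(M). *)
Definition enough_variables (Sg : nat -> Type) (M : matrix Sg) : Prop :=
  forall X : set M, ~ TT M X ->
    exists ps : M -> nat, forall x y, X x -> X y -> ps x = ps y -> x = y.

Definition countable_signature (Sg : nat -> Type) : Prop :=
  forall k, countable [set: Sg k].

(* Main.v *)
Require Import Defs.
From mathcomp Require Import all_boot.
From mathcomp Require Import all_classical.

(* If a statement has no analytic proof, there is a pair Om of sets of formulas
   within the universe U that extends its antecedent, avoids its succedent and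
   respects every rule instance within U: otherwise each such pair can be
   expanded by an instance violated at it, and iterating this transfinitely
   gives a proof.  The (E) rules then assign to each phi in W (the subformulas of
   the statement, or all formulas) a value x such that Theta^x(phi) fits Om; the
   (D) rules make these values verify the statement, the (Sigma) rules make them
   respect the connectives on W, and the (T) rules put them inside a total
   submatrix, where the partial valuation extends to a countermodel.  With W the
   set of all formulas no extension is needed, so completeness needs no
   restriction on the number of variables.  Analyticity follows by soundness. *)

Set Implicit Arguments.
Unset Strict Implicit.
Unset Printing Implicit Defensive.

Local Open Scope classical_set_scope.

(** * The tree of paths of an expansion relation *)

Section PathTree.

Variable Sg : nat -> Type.

(** The star is the greatest label, so every expansion moves upwards. *)
Definition le_label (K H : option (spair Sg)) : Prop :=
  match K, H with
  | _, None => True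
  | None, Some _ => False
  | Some G, Some G' => forall c, G c `<=` G' c
  end.

Definition lt_label (K H : option (spair Sg)) : Prop :=
  le_label K H /\ K <> H.

Lemma le_label_refl K : le_label K K.
Proof. by case: K => [G c|]. Qed.

Lemma le_label_trans J K H : le_label J K -> le_label K H -> le_label J H.
Proof.
case: J K H => [G|] [G'|] [G''|] //= JK KH c.
exact: subset_trans (KH c).
Qed.

Lemma le_label_anti K H : le_label K H -> le_label H K -> K = H.
Proof.
case: K H => [G|] [G'|] //= KH HK; congr Some; apply: funext => c.
by apply/seteqP; split; [apply: KH | apply: HK].
Qed.

Lemma lt_le_label_trans J K H : lt_label J K -> le_label K H -> lt_label J H.
Proof.
move=> [JK neJK] KH; split; first exact: le_label_trans KH.
by move=> eJH; apply: neJK; apply: le_label_anti => //; rewrite eJH.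
Qed.

Lemma le_lt_label_trans J K H : le_label J K -> lt_label K H -> lt_label J H.
Proof.
move=> JK [KH neKH]; split; first exact: le_label_trans KH.
by move=> eJH; apply: neKH; apply: le_label_anti => //; rewrite -eJH.
Qed.

Lemma le_lt_labelF K H : le_label K H -> ~ lt_label H K.
Proof. by move=> KH [HK]; apply; apply: le_label_anti. Qed.

(** Away from the star this is the union that [derivation] prescribes at limit nodes. *)
Definition sup_label (D : set (option (spair Sg))) : option (spair Sg) :=
  if pselect (D None) then None
  else Some (fun c => [set phi | exists2 G, D (Some G) & G c phi]).

Lemma sup_label_ub D K : D K -> le_label K (sup_label D).
Proof.
rewrite /sup_label; case: (pselect (D None)) => [DN|nD]; first by case: K.
by case: K => //= G DG c phi Gphi; exists G.
Qed.

Lemma sup_label_le D H :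
  (forall K, D K -> le_label K H) -> le_label (sup_label D) H.
Proof.
rewrite /sup_label; case: (pselect (D None)) => [DN|nD] DH; first exact: DH.
by case: H DH => //= G DG c phi [G' /DG]; apply.
Qed.

Variables (r : option (spair Sg)).
Variable step : option (spair Sg) -> option (spair Sg) -> Prop.
Hypothesis step_lt : forall K H, step K H -> lt_label K H.

(** * Paths and their initial segments *)

Definition below (C : set (option (spair Sg))) H : set (option (spair Sg)) :=
  C `&` [set K | lt_label K H].

Definition upto (C : set (option (spair Sg))) H : set (option (spair Sg)) :=
  C `&` [set K | le_label K H].

Definition successor (D : set (option (spair Sg))) K : Prop :=
  exists2 J, step J K & D J /\ forall J', D J' -> le_label J' J.

(* A node of the tree is encoded by the well-ordered set of all labels met on the
   way to it from the root, so that the tree order is the initial segment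
   relation. *)
Record path (C : set (option (spair Sg))) (H : option (spair Sg)) : Prop :=
  Path {
    path_root : C r;
    path_top : C H;
    path_ge : forall K, C K -> le_label r K;
    path_le : forall K, C K -> le_label K H;
    path_wo : forall B, B `<=` C -> B !=set0 ->
      exists2 K, B K & forall K', B K' -> le_label K K';
    path_next : forall K, C K -> K <> r ->
      successor (below C K) K \/ K = sup_label (below C K)
  }.

Lemma path_total C H K K' : path C H -> C K -> C K' ->
  le_label K K' \/ lt_label K' K.
Proof.
move=> pC CK CK'; case: (@path_wo _ _ pC [set K; K']).
- by move=> J [->|->].
- by exists K; left.
move=> J [->|->] JB; first by left; apply: JB; right.
have K'K : le_label K' K by apply: JB; left.
have [->|ne] := pselect (K = K'); first by left; exact: le_label_refl.
by right; split=> // e; apply: ne.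
Qed.

Lemma below_upto C H K : le_label K H -> below (upto C H) K = below C K.
Proof.
move=> KH; apply/seteqP; split=> J [] CJ JK; first by case: CJ.
by split=> //; split=> //; apply: le_label_trans KH; case: JK.
Qed.

Lemma upto_upto C H K : le_label K H -> upto (upto C H) K = upto C K.
Proof.
move=> KH; apply/seteqP; split=> J [] CJ JK; first by case: CJ.
by split=> //; split=> //; apply: le_label_trans KH.
Qed.

Lemma path_upto C H K : path C H -> C K -> path (upto C K) K.
Proof.
move=> pC CK; split.
- by split; [exact: path_root pC | exact: path_ge pC _ _].
- by split=> //; exact: le_label_refl.
- by move=> J [CJ _]; exact: path_ge pC _ _.
- by move=> J [_ JK].
- by move=> B BC; apply: (path_wo pC) => J /BC[].
- by move=> J [CJ JK] Jr; rewrite below_upto //; exact: path_next pC _ _ Jr.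
Qed.

Lemma upto_top C H : path C H -> upto C H = C.
Proof.
move=> pC; apply/seteqP; split=> K; first by case.
by move=> CK; split=> //; exact: path_le pC _ _.
Qed.

(** Transfinite induction: a least label violating [Q] could be neither the root, nor a successor,
    nor a supremum of earlier labels. *)
Lemma path_ind_on C H (Q : option (spair Sg) -> Prop) : path C H -> Q r ->
  (forall J K, C J -> Q J -> step J K -> Q K) ->
  (forall D, (forall K, D K -> Q K) -> Q (sup_label D)) ->
  forall K, C K -> Q K.
Proof.
move=> pC Qr Qs Ql K CK; apply: contrapT => nQK.
have [||J [CJ nQJ] Jmin] := @path_wo _ _ pC (C `&` ~` Q).
- by move=> ? [].
- by exists K.
have belowQ J' : below C J J' -> Q J'.
  move=> [CJ' J'J]; apply: contrapT => nQJ'.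
  exact: le_lt_labelF (Jmin J' (conj CJ' nQJ')) J'J.
have Jr : J <> r by move=> e; apply: nQJ; rewrite e.
have [[J' stJ' [bJ' _]]|eJ] := path_next pC CJ Jr.
  by apply: nQJ; apply: Qs stJ'; [case: bJ' | exact: belowQ].
by apply: nQJ; rewrite eJ; apply: Ql.
Qed.

Lemma path_single : path [set r] r.
Proof.
split=> //; try by move=> K ->; exact: le_label_refl.
move=> B Br [K BK]; exists K => // K' /Br ->.
by rewrite (Br _ BK); exact: le_label_refl.
Qed.

(** * The tree order on paths *)

Definition path_tree : ltree Sg :=
  @LTree Sg
    {p : set (option (spair Sg)) * option (spair Sg) | path p.1 p.2}
    (fun n m => (sval m).1 (sval n).2 /\
                (sval n).1 = upto (sval m).1 (sval n).2)
    (exist (fun p => path p.1 p.2) ([set r], r) path_single)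
    (fun n => (sval n).2).

Definition Node C H (pC : path C H) : path_tree :=
  exist (fun p => path p.1 p.2) (C, H) pC.

Lemma path_node_inj (n m : path_tree) :
  (sval n).1 = (sval m).1 -> (sval n).2 = (sval m).2 -> n = m.
Proof.
case: n m => [[C H] pC] [[C' H'] pC'] /= eC eH; subst C' H'.
by congr exist; apply: Prop_irrelevance.
Qed.

Lemma path_tle_label (n m : path_tree) :
  tle n m -> le_label (label n) (label m).
Proof. by case: m => [[C H] pC] [/= /(path_le pC)]. Qed.

Lemma path_tle_refl (n : path_tree) : tle n n.
Proof.
case: n => [[C H] pC]; split=> /=; first exact: path_top pC.
by rewrite (upto_top pC).
Qed.

Lemma path_tle_anti (n m : path_tree) : tle n m -> tle m n -> n = m.
Proof.
move=> nm mn; have eH : (sval n).2 = (sval m).2.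
  by apply: le_label_anti; apply: path_tle_label.
apply: path_node_inj => //; rewrite nm.2 eH.
by rewrite (upto_top (svalP m)).
Qed.

Lemma path_tle_trans (l m n : path_tree) : tle l m -> tle m n -> tle l n.
Proof.
move=> lm mn; have le := path_tle_label lm; case: lm mn => lm el [mn em].
move: lm; rewrite em => -[lm _]; split=> //.
by rewrite el em upto_upto.
Qed.

Lemma path_tlt_label (n m : path_tree) :
  tlt n m -> lt_label (label n) (label m).
Proof.
move=> [nm ne]; split; first exact: path_tle_label.
move=> e; apply: ne; apply: path_node_inj => //.
by rewrite nm.2 [(sval n).2]e (upto_top (svalP m)).
Qed.

(** Ancestors of [n] are initial segments of one path, so comparing their top labels compares the
    nodes. *)
Lemma path_tle_ancestors (l m n : path_tree) :
  tle l n -> tle m n -> le_label (label l) (label m) -> tle l m.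
Proof.
move=> [ln el] [mn em] le; split; first by rewrite em.
by rewrite em upto_upto.
Qed.

(** As [C] may lack a greatest element, this serves both the expansion of a last label and the limit
    of a chain of paths. *)
Lemma path_add C H : (forall K, C K -> lt_label K H) -> C r ->
  (forall B, B `<=` C -> B !=set0 ->
      exists2 K, B K & forall K', B K' -> le_label K K') ->
  (forall K, C K -> le_label r K) ->
  (forall K, C K -> K <> r ->
     successor (below C K) K \/ K = sup_label (below C K)) ->
  successor C H \/ H = sup_label C ->
  path (C `|` [set H]) H.
Proof.
move=> CH Cr Cwo Cge Cnext Hnext.
have belowH K : le_label K H -> below (C `|` [set H]) K = below C K.
  move=> KH; apply/seteqP; split=> J [CJ JK]; split=> //; last by left.
  case: CJ => // eJ; rewrite eJ in JK.
  by case: (le_lt_labelF KH JK).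
have bC : below C H = C.
  by apply/seteqP; split=> K; [case|move=> CK; split=> //; apply: CH].
split.
- by left.
- by right.
- by move=> K [/Cge //|->]; case: (CH _ Cr).
- by move=> K [/CH[]//|->]; exact: le_label_refl.
- move=> B BC [K0 BK0].
  (* The new top lies above [C], so a least element of [B] is sought in [C] first. *)
  have [[K [BK CK]]|nBC] := pselect (B `&` C !=set0).
    have [||J [BJ CJ] Jmin] := Cwo (B `&` C).
    - by move=> ? [].
    - by exists K.
    exists J => // K' BK'; case: (BC _ BK') => [CK'|->]; first exact: Jmin.
    by case: (CH _ CJ).
  have BH K : B K -> K = H.
    by move=> BK; case: (BC _ BK) => // CK; case: nBC; exists K.
  exists K0 => // K' /BH ->; rewrite (BH _ BK0); exact: le_label_refl.
- move=> K [CK|->] Kr; rewrite belowH.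
  + exact: Cnext.
  + by case: (CH _ CK).
  + by rewrite bC.
  + exact: le_label_refl.
Qed.

(** * Expansions as children *)

Lemma path_step C H K : path C H -> step H K -> path (C `|` [set K]) K.
Proof.
move=> pC /[dup] HK /step_lt ltHK; apply: path_add.
- by move=> J /(path_le pC) JH; exact: le_lt_label_trans ltHK.
- exact: path_root pC.
- exact: path_wo pC.
- exact: path_ge pC.
- exact: path_next pC.
- left; exists H => //; split; [exact: path_top pC | exact: path_le pC].
Qed.

Lemma upto_add C H K : path C H -> lt_label H K ->
  upto (C `|` [set K]) H = C.
Proof.
move=> pC HK; apply/seteqP; split=> J.
  by move=> [[//|->] KH]; case: (le_lt_labelF KH HK).
by move=> CJ; split; [left | apply: (path_le pC)].
Qed.

Lemma path_step_child C H K (pC : path C H) (HK : step H K) :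
  child (Node pC) (Node (path_step pC HK)).
Proof.
have ltHK := step_lt HK; split.
  split; last by case: ltHK => _ ne /(congr1 (@label _ _)).
  by split=> /=; [left; exact: path_top pC | rewrite upto_add].
move=> [k [nk km]]; have ltkm := path_tlt_label km.
have ltnk := path_tlt_label nk.
case: (km) => -[/= [Ck|ek] _] _.
  exact: (le_lt_labelF (path_le pC Ck) ltnk).
by case: ltkm => _; apply.
Qed.

Lemma path_child_below (n m : path_tree) J :
  child n m -> below (sval m).1 (label m) J -> le_label J (label n).
Proof.
move=> [nm nbetween]; have pm := svalP m; have [[Cn en] _] := nm.
move=> [CJ Jm]; have [//|nJ] := path_total pm CJ Cn.
case: nbetween; exists (Node (path_upto pm CJ)); split; last first.
  by split=> // e; case: Jm => _; apply; exact: (congr1 (@label _ _) e).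
split; last by case: nJ => _ ne /(congr1 (@label _ _)).
apply: (path_tle_ancestors (n := m)); [exact: nm.1 | by [] |].
by case: nJ.
Qed.

(** The path of a child is that of its parent with one label added. This yields the only child
    required for an empty succedent. *)
Lemma path_child_uniq (n m m' : path_tree) :
  child n m -> child n m' -> label m = label m' -> m = m'.
Proof.
suff childE k : child n k -> (sval k).1 = (sval n).1 `|` [set label k].
  move=> nm nm' e; apply: path_node_inj => //.
  by rewrite (childE m) // (childE m') // e.
move=> nk; have pk := svalP k; have [[[Cn en] _] _] := nk.
apply/seteqP; split=> K.
  move=> kK; have [->|Kk] := pselect (K = label k); first by right.
  left; rewrite en; split=> //; apply: (path_child_below nk).
  by split=> //; split=> //; exact: (path_le pk).
by move=> [|->]; [rewrite en => -[] | exact: path_top pk].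
Qed.

Lemma path_child_step (n m : path_tree) :
  child n m -> step (label n) (label m).
Proof.
move=> nm; have ltnm := path_tlt_label nm.1.
have pm := svalP m; have [[[Cn en] _] _] := nm.
have lastn J := @path_child_below _ _ J nm.
have bn : below (sval m).1 (sval m).2 (label n) by [].
have mr : (sval m).2 <> r.
  move=> e; apply: (le_lt_labelF _ ltnm); rewrite /= e.
  exact: (path_ge pm).
have [[J Jm [bJ Jmax]]|em] := path_next pm (path_top pm) mr.
  suff -> : label n = J by [].
  by apply: le_label_anti; [apply: Jmax | apply: lastn].
(* All earlier labels are at most that of [n], hence so would be their supremum [label m]. *)
case: (le_lt_labelF _ ltnm); rewrite /= {1}em.
exact: sup_label_le.
Qed.

Lemma path_tree_nleaf (n : path_tree) :
  ~ leaf n -> exists K, step (label n) K.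
Proof.
move=> nl; have [m nm] : exists m, tlt n m.
  apply: contrapT => nex; apply: nl => m nm; apply: contrapT => ne.
  by apply: nex; exists m; split=> // e; apply: ne.
have ltnm := path_tlt_label nm.
have pm := svalP m; have [[Cn en] _] := nm.
(* On the path to a proper descendant [m], the least label above that of [n] tops a child of [n]. *)
have [||K [CK nK] Kmin] := path_wo pm (B := (sval m).1 `&` lt_label (label n)).
- by move=> ? [].
- by exists (label m); split=> //; exact: path_top pm.
exists K; apply: (@path_child_step n (Node (path_upto pm CK))); split.
  split; last by case: nK => _ ne /(congr1 (@label _ _)).
  apply: (path_tle_ancestors (n := m)); [exact: nm.1 | by [] |].
  by case: nK.
move=> [k [nk kK]]; have /= ltkK := path_tlt_label kK.
apply: le_lt_labelF ltkK; apply: Kmin; split; last exact: path_tlt_label.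
by case: kK => -[/= []].
Qed.

Lemma path_child_ex (n : path_tree) K :
  step (label n) K -> exists2 m, child n m & label m = K.
Proof.
case: n => [[C H] pC] HK; exists (Node (path_step pC HK)) => //.
exact: path_step_child.
Qed.

Lemma path_tree_leafP (n : path_tree) : leaf n <-> ~ exists K, step (label n) K.
Proof.
split=> [lf [K /path_child_ex[m [[nm ne] _] _]]|nst]; last first.
  by apply: contrapT => /path_tree_nleaf.
by apply: ne; rewrite (lf _ nm).
Qed.

(** By maximality a greatest node of a branch is a leaf. A branch without one would be prolonged by
    the union of its paths, topped by the supremum of the labels. *)
Lemma path_tree_branch (B : set path_tree) :
  branch B -> exists2 n, B n & leaf n.
Proof.
move=> [Btot Bmax].
have Bext m : (forall n, B n -> tle n m) -> B m.
  move=> Bm; rewrite -(Bmax (B `|` [set m])); [by right| |by move=> ?; left].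
  move=> x y [Bx|->] [By|->].
  - exact: Btot.
  - by left; apply: Bm.
  - by right; apply: Bm.
  - by left; apply: path_tle_refl.
have [[n Bn nmax]|nomax] := pselect (exists2 n, B n & forall m, B m -> tle m n).
  exists n => // m nm; apply: path_tle_anti => //.
  apply: (nmax); apply: Bext => k Bk; apply: path_tle_trans nm; exact: nmax.
exfalso.
pose C : set (option (spair Sg)) := \bigcup_(n in B) (sval n).1.
have Bcmp n m : B n -> B m -> ~ tle m n -> tle n m.
  by move=> Bn Bm nmn; case: (Btot _ _ Bn Bm).
have uptoC n : B n -> upto C (label n) = (sval n).1.
  move=> Bn; apply/seteqP; split=> K.
    move=> [[m Bm CK] Kn]; have [mn|nm] := Btot _ _ Bm Bn.
      by move: CK; rewrite mn.2 => -[].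
    by rewrite nm.2; split.
  move=> nK; split; first by exists n.
  exact: (path_le (svalP n)).
have Cnomax n : B n -> exists2 K, C K & lt_label (label n) K.
  move=> Bn; have [m [Bm nmn]] : exists m, B m /\ ~ tle m n.
    apply: contrapT => nex; apply: nomax; exists n => // m Bm.
    by apply: contrapT => nmn; apply: nex; exists m.
  exists (label m); first by exists m => //; exact: path_top (svalP m).
  apply: path_tlt_label; split; first exact: Bcmp.
  by move=> e; apply: nmn; rewrite e; exact: path_tle_refl.
have Clt K : C K -> lt_label K (sup_label C).
  move=> [n Bn nK]; have [K' CK' ltK'] := Cnomax n Bn.
  apply: lt_le_label_trans (sup_label_ub CK').
  by apply: le_lt_label_trans ltK'; exact: (path_le (svalP n)).
have [n0 Bn0] : B !=set0.
  apply/set0P/eqP => B0; suff : B (troot path_tree) by rewrite B0.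
  by apply: Bext => n; rewrite B0.
have Cbelow n K : B n -> (sval n).1 K -> below C K = below (sval n).1 K.
  move=> Bn nK; rewrite -uptoC // below_upto //.
  exact: (path_le (svalP n)).
have pC : path (C `|` [set sup_label C]) (sup_label C).
  apply: path_add => //.
  - by exists n0 => //; exact: path_root (svalP n0).
  (* A minimum of [D] within the path of [n] is global: labels off that path lie on a longer one,
     above the label of [n]. *)
  - move=> D DC [K DK]; have [n Bn nK] := DC _ DK.
    have [||J [DJ nJ] Jmin] := path_wo (svalP n) (B := D `&` (sval n).1).
    - by move=> ? [].
    - by exists K.
    exists J => // K' DK'.
    have [nK'|nnK'] := pselect ((sval n).1 K'); first by apply: Jmin.
    have [m Bm mK'] := DC _ DK'.
    have nm : tle n m.
      by apply: Bcmp => // mn; apply: nnK'; move: mK'; rewrite mn.2 => -[].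
    have mJ : (sval m).1 J by move: nJ; rewrite nm.2 => -[].
    have [KJ|[]//] := path_total (svalP m) mK' mJ.
    case: nnK'; rewrite nm.2; split=> //; apply: le_label_trans KJ _.
    exact: (path_le (svalP n)).
  - by move=> K [n Bn nK]; exact: path_ge (svalP n) _ nK.
  - move=> K [n Bn nK]; rewrite (Cbelow n) //.
    exact: path_next (svalP n) _ nK.
  - by right.
apply: nomax; exists (Node pC); last first.
  move=> n Bn; split=> /=.
    by left; exists n => //; exact: path_top (svalP n).
  rewrite -uptoC //; apply/seteqP; split=> K.
    by move=> [CK Kn]; split=> //; left.
  move=> [[CK|->] Kn]; first by split.
  case: (le_lt_labelF Kn (Clt _ _)).
  by exists n => //; exact: path_top (svalP n).
apply: Bext => n Bn; split=> /=.
  by left; exists n => //; exact: path_top (svalP n).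
rewrite -uptoC //; apply/seteqP; split=> K.
  by move=> [CK Kn]; split=> //; left.
move=> [[CK|->] Kn]; first by split.
case: (le_lt_labelF Kn (Clt _ _)).
by exists n => //; exact: path_top (svalP n).
Qed.

Lemma path_tree_rooted : rooted_tree path_tree.
Proof.
split.
- split; [exact: path_tle_refl|exact: path_tle_anti|exact: path_tle_trans].
- move=> n; have pn := svalP n; split; first exact: path_root pn.
  apply/seteqP; split=> K /=.
    by move=> ->; split; [exact: path_root pn | exact: le_label_refl].
  by move=> [nK Kr]; apply: le_label_anti => //; exact: path_ge pn _ nK.
- move=> n B [m0 Bm0] Bn.
  have [||K [m Bm <-] Kmin] := path_wo (svalP n) (B := @label _ _ @` B).
  + by move=> _ [m /Bn [[nm _] _] <-].
  + by exists (label m0), m0.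
  exists m => // m' Bm'.
  apply: (@path_tle_ancestors _ _ n); [by case: (Bn m)|by case: (Bn m')|].
  by apply: Kmin; exists m'.
- exact: path_tree_branch.
Qed.

(** If the last label were a successor, the path up to its predecessor would be a parent of [n]. *)
Lemma path_tree_limit (n : path_tree) :
  n <> troot path_tree -> (forall m, ~ child m n) ->
  label n = sup_label (below (sval n).1 (label n)).
Proof.
move=> nr nch; have pn := svalP n.
have nr2 : (sval n).2 <> r.
  move=> e; apply: nr; apply: path_tle_anti; last by case: path_tree_rooted.
  split=> /=; rewrite e //.
  apply/seteqP; split=> K.
    move=> nK; split; last by rewrite -e; exact: (path_le pn).
    by apply: le_label_anti; [rewrite -e; apply: (path_le pn)
      |apply: (path_ge pn)].
  by move=> [-> _]; exact: path_root pn.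
have [[J Jn [[nJ ltJ] Jmax]]|//] := path_next pn (path_top pn) nr2.
case: (nch (Node (path_upto pn nJ))); split.
  by split=> // e; case: ltJ => _; apply; exact: (congr1 (@label _ _) e).
move=> [k [Jk kn]]; have ltJk := path_tlt_label Jk.
apply: le_lt_labelF ltJk; apply: Jmax; split; last exact: path_tlt_label.
by case: kn => -[].
Qed.

End PathTree.

(** * Proofs from the absence of saturated pairs *)

Section Extension.

Variables (Sg : nat -> Type) (Rc : calculus Sg) (Phi : statement Sg).
Variable U : set (formula Sg).

(** Instances whose succedent leaves [U] are disregarded, since expanding by them would take labels
    out of [U]. *)
Definition saturated (Om : spair Sg) : Prop :=
  [/\ forall c, Phi (Pl c) `<=` Om c,
      forall c phi, Phi (Ov c) phi -> ~ Om c phi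
    & forall (R : schema Sg) s, Rc R ->
        (forall c, subst s @` ant R c `<=` Om c) ->
        (forall c, subst s @` suc R c `<=` U) ->
        exists c, exists2 psi, suc R c psi & Om c (subst s psi)].

Definition open_label (G : spair Sg) : Prop :=
  [/\ forall c, Phi (Pl c) `<=` G c, forall c, G c `<=` U
    & forall c phi, Phi (Ov c) phi -> ~ G c phi].

Definition fresh_instance (G : spair Sg) (R : schema Sg) s : Prop :=
  [/\ Rc R, forall c, subst s @` ant R c `<=` G c,
      forall c, subst s @` suc R c `<=` U
    & forall c psi, suc R c psi -> ~ G c (subst s psi)].

(** [inst] fixes one instance per label. The star and the labels meeting the succedent of [Phi] have
    no expansion, so they become leaves. *)
Definition expansion (inst : spair Sg -> schema Sg * (nat -> formula Sg))
    (K H : option (spair Sg)) : Prop :=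
  exists G, [/\ K = Some G, open_label G &
    ((forall c, suc (inst G).1 c = set0) /\ H = None) \/
    exists c, exists2 psi, suc (inst G).1 c psi
      & H = Some (extend G c (subst (inst G).2 psi))].

(* As every instance used is fresh, labels grow strictly along paths, so that
   no bookkeeping of the instances still to be treated is needed. *)
Lemma unsaturated_proof : (forall c, Phi (Pl c) `<=` U) ->
  ~ (exists Om, saturated Om) ->
  exists2 t : ltree Sg, proof_of Rc Phi t &
     forall (n : t) G, label n = Some G -> forall c, G c `<=` U.
Proof.
move=> PhiU nsat.
have [inst instP] : {inst : spair Sg -> schema Sg * (nat -> formula Sg) |
    forall G, open_label G -> fresh_instance G (inst G).1 (inst G).2}.
  suff /choice[inst instP] : forall G,
      exists Rs : schema Sg * (nat -> formula Sg),
    open_label G -> fresh_instance G Rs.1 Rs.2 by exists inst.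
  (* If no instance were fresh at an open [G], then [G] would be saturated. The empty schema is a
     dummy for labels that are not open. *)
  move=> G; apply: contrapT => nex; apply: nsat; exists G.
  have opG : open_label G.
    by apply: contrapT => nop; apply: nex;
      exists (Schema (fun=> set0) (fun=> set0), Var).
  case: (opG) => PG GU PO; split=> // R s RcR antG sucU.
  apply: contrapT => nG; apply: nex; exists (R, s) => _.
  split=> // c psi psiR Gpsi.
  by apply: nG; exists c, psi.
pose step := expansion inst.
have step_lt K H : step K H -> lt_label K H.
  move=> [G [-> /instP[_ _ _ fresh] [[_ ->//]|[c [psi psiR ->]]]]].
  split; first by move=> b phi Gphi; left.
  by move=> [e]; apply: (fresh _ _ psiR); rewrite [G in G c]e; right.
pose r : option (spair Sg) := Some (fun c => Phi (Pl c)).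
pose t := path_tree r step.
have labelU (n : t) G : label n = Some G -> forall c, G c `<=` U.
  pose Q (K : option (spair Sg)) :=
    forall G, K = Some G -> forall c, G c `<=` U.
  suff : Q (label n) by apply.
  apply: (path_ind_on (Q := Q) (svalP n)); last exact: path_top (svalP n).
  - by move=> _ [<-].
  - move=> J K _ QJ [G0 [eJ opG0 [[_ -> //]|[c [psi psiR ->]]]]] _ [<-] b phi.
    case: (opG0) => _ G0U _ [/G0U //|[_ ->]].
    case: (instP _ opG0) => _ _ sucU _.
    by apply: (sucU c); exists psi.
  - move=> D QD G0; rewrite /sup_label.
    case: (pselect (D None)) => //= _ [<-] c phi.
    by move=> [G1 DG1 G1phi]; apply: QD DG1 _ erefl _ _ G1phi.
exists t => //; split.
- split; first exact: path_tree_rooted.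
  + move=> n /path_tree_nleaf[_ [G [eG opG _]]].
    case: (instP _ opG) => RcR antG sucU fresh.
    exists G, (inst G).1, (inst G).2; split=> //; split=> //.
    * move=> suc0; have [|m nm em] := @path_child_ex _ _ _ step_lt n None.
        exists G; split=> //; left; split=> //.
      exists m; split=> // m'; split=> [nm'|-> //].
      apply: (path_child_uniq nm' nm); rewrite em.
      have [G' [eG' _]] := path_child_step nm'.
      move: eG'; rewrite eG => -[<-] [[_ ->//]|[c [psi psiR _]]].
      by move: psiR; rewrite suc0.
    * move=> [c0 [psi0 psi0R]]; split.
        move=> c psi psiR; have [|m nm em] := @path_child_ex _ _ _ step_lt n
            (Some (extend G c (subst (inst G).2 psi))).
          by exists G; split=> //; right; exists c, psi.
        by exists m.
      move=> m nm; have [G' [eG' _]] := path_child_step nm.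
      move: eG'; rewrite eG => -[<-] [[suc0 _]|//].
      by move: psi0R; rewrite suc0.
  + move=> n nr nch; rewrite (path_tree_limit nr nch) /sup_label.
    (* The star, being greatest, cannot occur strictly below the label of [n]. *)
    case: (pselect _) => [[_ [nN neN]]|_] /=.
      by case: neN; move: nN; rewrite /le_label; case: (label n).
    congr Some; apply: funext => c; apply/seteqP; split=> phi.
      move=> [G [nG ltG] Gphi]; exists (Node (path_upto (svalP n) nG)), G.
      split=> //; split=> // e; case: ltG => _; apply.
      exact: (congr1 (@label _ _) e).
    move=> [m [G [mn eG Gphi]]]; exists G => //; rewrite -eG.
    by split; [case: mn => -[] | exact: path_tlt_label].
- by exists (fun c => Phi (Pl c)) => // c phi.
- move=> n /(path_tree_leafP step_lt) nst.
  have [eN|[G eG]] : label n = None \/ exists G, label n = Some G.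
    by case: (label n) => [G|]; [right; exists G | left].
    by left.
  right; exists G => //; apply: contrapT => nclash.
  (* A leaf disjoint from the succedent of [Phi] would be open, and its instance would give it a
     child. *)
  have opG : open_label G.
    split; last by move=> c phi Ophi Gphi; apply: nclash; exists c, phi.
      by have := path_ge (svalP n) (path_top (svalP n)); rewrite [_.2]eG.
    exact: labelU eG.
  apply: nst.
  have [suc0|nsuc0] := pselect (forall c, suc (inst G).1 c = set0).
    exists None, G; split=> //; left; split=> //.
  have [c /eqP/set0P[psi psiR]] : exists c, suc (inst G).1 c <> set0.
    by apply: contrapT => nex; apply: nsuc0 => c;
      apply: contrapT => ne; apply: nex; exists c.
  exists (Some (extend G c (subst (inst G).2 psi))), G.
  by split=> //; right; exists c, psi.
Qed.

End Extension.

(** * Soundness *)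

Lemma subst_comp (Sg : nat -> Type) (s t : nat -> formula Sg) phi :
  subst s (subst t phi) = subst (fun i => subst s (t i)) phi.
Proof.
by elim: phi => //= k c args IH; congr App; apply: funext => i; apply: IH.
Qed.

Lemma subf_refl (Sg : nat -> Type) (phi : formula Sg) : subf phi phi.
Proof. by case: phi => [i|k c args] //=; left. Qed.

Lemma subf_arg (Sg : nat -> Type) (psi : formula Sg) k (c : Sg k) args i :
  subf psi (App c args) -> subf psi (args i).
Proof.
elim: psi => [//|k' c' args' IH] /= [e|[j _ /IH ?]]; last by right; exists j.
change (subf (App c' args') (args i)); rewrite -e.
by right; exists i => //; exact: subf_refl.
Qed.

Section Soundness.

Variables (Sg : nat -> Type) (M : matrix Sg).

Lemma valuation_subst (v : formula Sg -> M) s :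
  valuation v -> valuation (fun phi => v (subst s phi)).
Proof. by move=> vv k c args; apply: vv. Qed.

Lemma values_subst (v : formula Sg -> M) phi psi :
  valuation v -> values psi (v phi) (v (subst (fun=> phi) psi)).
Proof.
by move=> vv; exists (fun chi => v (subst (fun=> phi) chi)); split.
Qed.

(** Quantifying over all valuations covers all instances, as a valuation composed with a
    substitution is again a valuation. *)
Definition sound_schema (R : schema Sg) : Prop :=
  forall v : formula Sg -> M, valuation v ->
    (forall c psi, ant R c psi -> des M c (v psi)) ->
    exists c, exists2 psi, suc R c psi & des M c (v psi).

Lemma ancestors_total (t : ltree Sg) (k m n : t) : rooted_tree t ->
  tle m k -> tle n k -> tle m n \/ tle n m.
Proof.
case=> [[rfl _ _] _ wo _] mk nk.
have [<-|mk'] := pselect (k = m); first by right.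
have [<-|nk'] := pselect (k = n); first by left.
have [||j [->|->] jmin] := wo k [set m; n]; last 2 first.
- by left; apply: jmin; right.
- by right; apply: jmin; left.
- by exists m; left.
- by move=> j [->|->]; split=> // e; [apply: mk'|apply: nk'].
Qed.

(* The nodes whose label is verified by a countermodel contain, by Zorn's lemma,
   a maximal chain closed under ancestors; soundness of the rules makes it a
   branch, whose leaf contradicts the countermodel. *)
Lemma proof_sound (Rc : calculus Sg) (Phi : statement Sg) :
  (forall R, Rc R -> sound_schema R) -> provable Rc Phi -> holds M Phi.
Proof.
move=> sound [t [[rt expand limit] [G0 eG0 G0Phi] leaves]] [v vv vPhi].
pose ok (n : t) := exists2 G, label n = Some G &
  forall c phi, G c phi -> des M c (v phi).
pose P (C : set t) := [/\ total_on C (@tle Sg t),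
  forall m n, C n -> tle m n -> C m & forall n, C n -> ok n].
have [|C [[Ctot Cdown Cok] Cmax]] := @Zorn_bigcup t P.
  move=> F FP Ftot; split.
  - move=> m n [X FX Xm] [Y FY Yn]; have [XY|YX] := Ftot _ _ FX FY.
      by have [tot _ _] := FP _ FY; apply: tot => //; apply: XY.
    by have [tot _ _] := FP _ FX; apply: tot => //; apply: YX.
  - move=> m n [X FX Xn] mn; exists X => //.
    by have [_ down _] := FP _ FX; apply: down mn.
  - by move=> n [X FX Xn]; have [_ _ allok] := FP _ FX; apply: allok.
have [[rfl anti trans] rootle wo branches] := rt.
have rootok : ok (troot t).
  by exists G0 => // c phi /G0Phi Pphi; apply: (vPhi (Pl c)); exists phi.
(* By maximality [C] contains every verified node that lies above it and has all proper ancestors in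
   it. *)
have Cext k : ok k -> (forall m, tlt m k -> C m) ->
    (forall m, C m -> tle m k) -> C k.
  move=> okk belowk abovek; apply: contrapT => nCk.
  apply: (Cmax (C `|` [set k])).
    by split=> [x Cx|sub]; [left | apply: nCk; apply: sub; right].
  split.
  - move=> m n [Cm|->] [Cn|->]; [exact: Ctot| | |by left].
    + by left; apply: abovek.
    + by right; apply: abovek.
  - move=> m n [Cn mn|-> mk]; first by left; apply: Cdown mn.
    have [->|ne] := pselect (m = k); first by right.
    by left; apply: belowk.
  - by move=> n [/Cok|->].
have Croot : C (troot t).
  apply: contrapT => nCr; apply: (nCr); apply: Cext => //.
  - by move=> m [mr ne]; case: ne; apply: (anti).
  - by move=> m Cm; case: nCr; apply: Cdown Cm _.
have [|n Cn lfn] := branches C; last first.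
  have [G eG GM] := Cok n Cn; case: (leaves n lfn) => [|[G']]; rewrite eG //.
  move=> [<-] [c [phi [Gphi Ophi]]].
  by apply: (vPhi (Ov c) (v phi)); [exists phi | apply: GM].
split=> // C' C'tot CC'; apply/seteqP; split=> // m C'm.
apply: contrapT => nCm.
have leqm n : C n -> tle n m.
  move=> Cn; have [//|mn] := C'tot _ _ (CC' _ Cn) C'm.
  by case: nCm; apply: Cdown mn.
(* If [C] has a greatest node, soundness verifies one of its children, which [C] would then
   contain. *)
have [[n Cn nmax]|nomax] := pselect (exists2 n, C n & forall j, C j -> tle j n).
  have nleaf : ~ leaf n.
    by move=> lf; apply: nCm; rewrite (lf m) //; apply: leqm.
  have [G [R [s [eG RcR [antG _ sucG]]]]] := expand _ nleaf.
  have [G' eG' GM] := Cok _ Cn; move: eG'; rewrite eG => -[eG']; subst G'.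
  have [|c [psi psiR psiM]] := sound _ RcR _ (valuation_subst s vv).
    by move=> c psi psiR; apply: GM; apply: antG; exists psi.
  have [|succ _] := sucG; first by exists c, psi.
  have [k nk ek] := succ _ _ psiR.
  suff Ck : C k.
    by case: nk => -[nk ne] _; apply: ne; apply: (anti) => //; apply: nmax.
  have [[nk' _] nbetween] := nk.
  apply: Cext.
  - exists (extend G c (subst s psi)) => // b phi [/GM //|[-> ->]].
    exact: psiM.
  - move=> j jk; have [||jn|nj] := @ancestors_total t k j n rt.
    + by case: jk.
    + by [].
    + exact: Cdown jn.
    + have [->//|ne] := pselect (j = n).
      case: nbetween; exists j; split=> //.
      by split=> // e; apply: ne.
  - by move=> j Cj; apply: trans nk'; apply: nmax.
(* Otherwise the first node [k] outside [C] on the way to [m] has no parent, so its label is a union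
   of verified labels. *)
have [k [km nCk belowk]] : exists k, [/\ tle k m, ~ C k &
    forall j, tlt j k -> C j].
  have [Bne|Be] := pselect (exists b, tlt b m /\ ~ C b).
    have [||k [[km kne] nCk] kmin] := wo m [set b | tlt b m /\ ~ C b].
    - by case: Bne => b; exists b.
    - by move=> b [].
    exists k; split=> // j [jk ne]; apply: contrapT => nCj; apply: ne.
    apply: (anti) => //; apply: kmin; split=> //; split; first exact: trans km.
    by move=> e; apply: kne; apply: (anti) => //; rewrite -e.
  exists m; split=> // j jm; apply: contrapT => nCj.
  by apply: Be; exists j.
have abovek j : C j -> tle j k.
  move=> Cj; have [||//|kj] := @ancestors_total t m j k rt.
  - exact: leqm.
  - by [].
  - by case: nCk; apply: Cdown kj.
have nroot : k <> troot t by move=> e; apply: nCk; rewrite e.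
have nchild n : ~ child n k.
  move=> [nk nbetween]; apply: nomax; exists n; first exact: belowk.
  move=> j Cj; apply: contrapT => njn; apply: nbetween; exists j.
  have [//|nj] := Ctot _ _ Cj (belowk _ nk).
  split; split=> //; first by move=> e; apply: njn; rewrite e.
    exact: abovek.
  by move=> e; apply: nCk; rewrite -e.
apply: nCk; apply: Cext => //.
eexists; first exact: limit.
move=> c phi [j [G [jk eG Gphi]]].
have [G' eG' GM] := Cok _ (belowk _ jk).
by move: eG'; rewrite eG => -[eG']; apply: GM; rewrite -eG'.
Qed.

(** * Soundness of the rules of the calculus *)

Section Calculus.

Variables (Theta : M -> statement Sg).

Definition rule_D (x : M) (c : cog) : schema Sg :=
  Schema
    (fun b => plug (Theta x (Pl b)) (Var pvar) `|`
       [set psi | b = c /\ pset (Ov c) x psi])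
    (fun b => plug (Theta x (Ov b)) (Var pvar) `|`
       [set psi | b = c /\ pset (Pl c) x psi]).

Lemma mkpair_add c (F : cog -> set (formula Sg)) (S : set (formula Sg)) :
  (match c with
   | cA => mkpair (F cA `|` S) (F cR)
   | cR => mkpair (F cA) (F cR `|` S)
   end) = (fun b => F b `|` [set psi | b = c /\ S psi]).
Proof.
case: c; apply: funext => -[]; apply/seteqP; split=> psi /=;
  by [left | case=> [|?]; [left|right] | case=> [|[_ ?]]; [left|right]
    | case=> [//|[]]].
Qed.

Lemma rule_DAE x :
  Schema
    (mkpair (plug (Theta x (Pl cA)) (Var pvar) `|` pset (Ov cA) x)
            (plug (Theta x (Pl cR)) (Var pvar)))
    (mkpair (plug (Theta x (Ov cA)) (Var pvar) `|` pset (Pl cA) x)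
            (plug (Theta x (Ov cR)) (Var pvar))) = rule_D x cA.
Proof.
congr Schema.
  exact: (mkpair_add cA (fun b => plug (Theta x (Pl b)) _)).
exact: (mkpair_add cA (fun b => plug (Theta x (Ov b)) _)).
Qed.

Lemma rule_DRE x :
  Schema
    (mkpair (plug (Theta x (Pl cA)) (Var pvar))
            (plug (Theta x (Pl cR)) (Var pvar) `|` pset (Ov cR) x))
    (mkpair (plug (Theta x (Ov cA)) (Var pvar))
            (plug (Theta x (Ov cR)) (Var pvar) `|` pset (Pl cR) x)) =
  rule_D x cR.
Proof.
congr Schema.
  exact: (mkpair_add cR (fun b => plug (Theta x (Pl b)) _)).
exact: (mkpair_add cR (fun b => plug (Theta x (Ov b)) _)).
Qed.

Lemma calc_D x c : calc Theta (rule_D x c).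
Proof. by case: c; rewrite -(rule_DAE, rule_DRE); constructor. Qed.

Hypothesis discr : discriminator Theta.
Hypothesis orient : oriented Theta.

(** Were [v phi] another value, orientation would give some [psi] in some [Theta x a] with no value
    at [v phi] in [dset M a]. *)
Lemma fit_value (v : formula Sg -> M) x phi : valuation v ->
  (forall a psi, Theta x a psi -> dset M a (v (subst (fun=> phi) psi))) ->
  v phi = x.
Proof.
move=> vv fit; apply: contrapT => /orient[a [psi xpsi]]; apply.
  exact: values_subst.
exact: fit.
Qed.

(** By [fit_value], a valuation violating a (D), (Sigma) or (T) rule takes the very values the rule
    names, which the rule's own conditions exclude. *)
Lemma calc_sound R : calc Theta R -> sound_schema R.
Proof.
move=> RR v vv antR; apply: contrapT => nex.
have nsuc c psi : suc R c psi -> ~ des M c (v psi).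
  by move=> psiR psiM; apply: nex; exists c, psi.
have fit S : R = Schema (fun b => S (Pl b)) (fun b => S (Ov b)) ->
    forall a psi, S a psi -> dset M a (v psi).
  by move=> eR -[] c psi Spsi; [apply: antR | apply: nsuc]; rewrite eR.
have fit_D x c : R = rule_D x c -> False.
  move=> eR; rewrite eR in antR nsuc.
  have vx : v (Var pvar) = x.
    apply: fit_value => // -[] b psi psiT; [apply: antR | apply: nsuc].
      by left; exists psi.
    by left; exists psi.
  have [xc|nxc] := pselect (des M c x).
    by apply: (nsuc c (Var pvar)); [right | rewrite vx].
  by apply: (nxc); rewrite -vx; apply: antR; right.
case: RR antR nsuc fit fit_D => {R nex}.
(* The formula chosen for the value of [p] has its value on the side its component states, which
   refutes the violation whether it stands in the antecedent or the succedent. *)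
- move=> X S T [f [fX Sf]] [g [gX Tg]] antS nsuc _ _.
  have fit_p a psi : Theta (v (Var pvar)) a psi -> dset M a (v psi).
    move=> psiT; have [_ _ /(_ _ _ psiT)] := discr (v (Var pvar)); apply.
    by exists v.
  have [Xp|nXp] := pselect (X (v (Var pvar))).
    apply: (fit_p _ _ (fX _ Xp)); apply: antS => /=; rewrite Sf.
    by eexists; [exact: Xp | case: (f _)].
  apply: (nsuc (g (v (Var pvar))).1 (g (v (Var pvar))).2) => /=.
    by rewrite Tg; eexists; [exact: nXp | case: (g _)].
  exact: fit_p (gX _ nXp).
- by move=> x _ _ _ /(_ _ _ (rule_DAE x)).
- by move=> x _ _ _ /(_ _ _ (rule_DRE x)).
- move=> k c xs y ps ny _ S _ _ /(_ S erefl) fit _; apply: ny.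
  suff [vxs <-] : (fun i => v (Var (ps i))) = xs /\
      v (App c (fun i => Var (ps i))) = y by rewrite -vxs; apply: vv.
  split.
    apply: funext => i; apply: fit_value => // a psi psiT.
    by apply: fit; left; exists i => //; exists psi.
  apply: fit_value => // a psi psiT.
  by apply: fit; right; exists psi.
- move=> X ps nX _ S _ _ /(_ S erefl) fit _; apply: nX.
  (* The range of [v] is closed under the outputs [v (App c args)], hence total. *)
  exists (range v); split.
  + by exists (v (Var pvar)), (Var pvar).
  + move=> k c xs; have /choice[args argsE] i :
        exists phi, v phi = sval (xs i).
      by case: (svalP (xs i)) => phi _ e; exists phi.
    have Xv : range v (v (App c args)) by exists (App c args).
    exists (exist _ _ Xv) => /=.
    have -> : (fun i => sval (xs i)) = (fun i => v (args i)).
      by apply: funext => i; rewrite argsE.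
    exact: vv.
  + move=> x Xx; exists (Var (ps x)) => //.
    apply: fit_value => // a psi psiT.
    by apply: fit; exists x => //; exists psi.
Qed.

End Calculus.

End Soundness.

(** * Countermodels from saturated pairs *)

Section Countermodel.

Variables (Sg : nat -> Type) (M : matrix Sg) (Theta : M -> statement Sg).
Variables (Phi : statement Sg) (W U : set (formula Sg)) (Om : spair Sg).

Definition att_in (a : att) : set (formula Sg) :=
  match a with Pl c => Om c | Ov c => ~` Om c end.

Definition fitting (phi : formula Sg) (x : M) : Prop :=
  forall a psi, Theta x a psi -> att_in a (subst (fun=> phi) psi).

Hypothesis satOm : saturated (calc Theta) Phi U Om.
Hypothesis W_Phi : forall a, Phi a `<=` W.
Hypothesis W_arg : forall k (c : Sg k) args i, W (App c args) -> W (args i).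
Hypothesis W_U : W `<=` U.
Hypothesis W_Theta : forall phi x a psi,
  W phi -> Theta x a psi -> U (subst (fun=> phi) psi).

Lemma saturated_instance (S : att -> set (formula Sg)) s :
  calc Theta (Schema (fun b => S (Pl b)) (fun b => S (Ov b))) ->
  (forall a psi, S a psi -> U (subst s psi) /\ att_in a (subst s psi)) -> False.
Proof.
move=> RR SU; have [_ _ closed] := satOm.
have [||c [psi Spsi Ompsi]] := closed _ s RR.
- by move=> c _ [psi /SU[_ ?] <-].
- by move=> c _ [psi /SU[? _] <-].
- by have [_] := SU _ _ Spsi.
Qed.

Lemma fitting_plug phi x n s a psi : W phi -> s n = phi -> fitting phi x ->
  plug (Theta x a) (Var n) psi -> U (subst s psi) /\ att_in a (subst s psi).
Proof.
move=> Wphi sn fit [chi Tchi <-]; rewrite subst_comp /= sn.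
by split; [exact: W_Theta Tchi | exact: fit].
Qed.

(** If no value fitted, a misplaced formula picked from each [Theta x] would give an (E) instance
    violated by [Om]. *)
Lemma fitting_ex phi : W phi -> exists x, fitting phi x.
Proof.
move=> Wphi; apply: contrapT => nfit.
have /choice[g gP] x : exists af : att * formula Sg,
    Theta x af.1 af.2 /\ ~ att_in af.1 (subst (fun=> phi) af.2).
  apply: contrapT => nex; apply: nfit; exists x => a psi psiT.
  by apply: contrapT => npsi; apply: nex; exists (a, psi).
pose f x := (match (g x).1 with Pl c => c | Ov c => c end, (g x).2).
(* Misplaced formulas from overlined components lie in [Om] and form the antecedent; the others lie
   outside [Om] and form the succedent. *)
pose X : set M := [set x | exists c, (g x).1 = Ov c].
pose S (Y : set M) c := [set psi | exists2 x, Y x & f x = (c, psi)].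
have [_ _ closed] := satOm.
have [|||c [psi [x nXx [ec epsi]]] Ompsi] :=
    closed (Schema (S X) (S (~` X))) (fun=> phi).
- apply: (rule_E (X := X)); exists f; split=> // x.
    by case=> c; have [gx _] := gP x; rewrite /f => ec; rewrite ec in gx *.
  move=> nXx; have [gx _] := gP x; rewrite /f; move: gx.
  by case e: (g x).1 => [c|c] //=; case: nXx; exists c.
- move=> c _ [psi [x [b eb] [ec epsi]] <-]; have [_] := gP x.
  by rewrite eb -epsi -ec eb => /contrapT.
- move=> c _ [psi [x _ [_ epsi]] <-]; rewrite -epsi.
  by have [gx _] := gP x; exact: W_Theta gx.
- have [_] := gP x; rewrite epsi; move: ec.
  by case e: (g x).1 => [b|b] //=; [move=> ->|case: nXx; exists b].
Qed.

(** A disagreement between [Om] and [x] about [phi] would violate a (D) instance at [phi]. *)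
Lemma fitting_dset phi x a : W phi -> fitting phi x ->
  att_in a phi -> dset M a x.
Proof.
move=> Wphi fit; have [_ _ closed] := satOm.
have main c : (Om c phi /\ ~ des M c x) \/ (~ Om c phi /\ des M c x) -> False.
  move=> dis.
  have [||b [psi + Ompsi]] := closed _ (fun=> phi) (calc_D Theta x c).
  - move=> b _ [psi [pl|[-> [nx ->]]] <-] /=.
      by have [] := fitting_plug (s := fun=> phi) Wphi erefl fit pl.
    by case: dis => [[]|[]].
  - move=> b _ [psi [pl|[_ [nx ->]]] <-] /=; last exact: W_U.
    by have [] := fitting_plug (s := fun=> phi) Wphi erefl fit pl.
  - case=> [pl|[eb [xc e]]].
      by have [] := fitting_plug (s := fun=> phi) Wphi erefl fit pl.
    by rewrite eb e /= in xc Ompsi; case: dis => [[]|[]].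
case: a => c /= aphi; last by move=> xc; apply: (main c); right.
by apply: contrapT => nxc; apply: (main c); left.
Qed.

Lemma fitting_interp k (c : Sg k) args xs y : W (App c args) ->
  (forall i, fitting (args i) (xs i)) -> fitting (App c args) y ->
  interp M c xs y.
Proof.
move=> Wc fitxs fity; apply: contrapT => nint.
(* The variables of the (Sigma) instance are the numbers below [k], and [s] sends each to the
   argument of that index. *)
pose s n := if insub n is Some i then args i else Var n.
have sE (i : 'I_k) : s i = args i by rewrite /s valK.
apply: (saturated_instance (s := s)
  (rule_Sg Theta nint (fun i j => @ord_inj k i j))).
move=> a psi [[i _]|[chi Tchi <-]].
  exact: (fitting_plug (W_arg _ Wc) (sE i) (fitxs i)).
rewrite subst_comp.
have -> : (fun=> subst s (App c (fun i : 'I_k => Var i))) =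
    (fun _ : nat => App c args).
  by apply: funext => _ /=; congr App; apply: funext => i; rewrite sE.
by split; [exact: W_Theta Tchi | exact: fity].
Qed.

Definition attained (v : formula Sg -> option M) : set M :=
  [set x | exists2 phi, W phi & v phi = Some x].

(** Otherwise [Om] would violate the (T) instance replacing each [ps x] by a formula of value
    [x]. *)
Lemma fitting_TT (v : formula Sg -> option M) (ps : M -> nat) :
  (forall phi x, W phi -> v phi = Some x -> fitting phi x) ->
  (forall x y, attained v x -> attained v y -> ps x = ps y -> x = y) ->
  TT M (attained v).
Proof.
move=> vfit psinj; apply: contrapT => nTT.
have /choice[s sP] n : exists phi, forall x, attained v x -> ps x = n ->
    W phi /\ v phi = Some x.
  have [[x [phi Wphi vphi] <-]|nex] :=
      pselect (exists2 x, attained v x & ps x = n).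
    exists phi => y vy /psinj -> //; by exists phi.
  by exists (Var n) => x vx ex; case: nex; exists x.
apply: (saturated_instance (s := s) (rule_T Theta nTT psinj)).
move=> a psi [x vx]; have [Ws vs] := sP _ _ vx erefl.
exact: (fitting_plug Ws erefl (vfit _ _ Ws vs)).
Qed.

(** Off [W], compound formulas are evaluated bottom up by [next], to be chosen inside a total
    sub-matrix. *)
Fixpoint extended (v : formula Sg -> option M) (x0 : M)
    (next : forall k, Sg k -> ('I_k -> M) -> M) (phi : formula Sg) : M :=
  if pselect (W phi) then odflt x0 (v phi) else
  match phi with
  | Var _ => x0
  | App k c args => next k c (fun i => extended v x0 next (args i))
  end.

Lemma countermodel (v : formula Sg -> option M) :
  (forall phi, W phi -> exists2 x, v phi = Some x & fitting phi x) ->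
  TT M (attained v) -> ~ holds M Phi.
Proof.
move=> vfit [X [[x0 Xx0] Xtot vX]]; apply; have [PhiOm PhinOm _] := satOm.
(* Totality supplies an output in [X] for arguments in [X]; elsewhere [x0] is a default. *)
have /choice[next nextP] (p : {k & (Sg k * ('I_k -> M))%type}) : exists y,
    (forall i, X ((projT2 p).2 i)) ->
    X y /\ interp M (projT2 p).1 (projT2 p).2 y.
  case: p => k [c xs] /=; have [Xxs|nXxs] := pselect (forall i, X (xs i)).
    have [[y Xy] /= cy] := Xtot k c (fun i => exist _ (xs i) (Xxs i)).
    by exists y.
  by exists x0.
pose w := extended v x0 (fun k c xs => next (existT _ k (c, xs))).
have wW phi x : W phi -> v phi = Some x -> w phi = x.
  by rewrite /w => Wphi vphi; case: phi Wphi vphi => [i|k c args] Wphi vphi /=;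
    case: pselect => //=; rewrite vphi.
have wX phi : X (w phi).
  elim: phi => [i|k c args IH]; rewrite /w /=.
    case: pselect => //= Wi; have [x vx _] := vfit _ Wi; rewrite vx /=.
    by apply: vX; exists (Var i).
  case: pselect => /= [Wc|_].
    have [x vx _] := vfit _ Wc; rewrite vx /=.
    by apply: vX; exists (App c args).
  by case: (nextP (existT _ k (c, fun i => w (args i)))).
exists w.
  move=> k c args; have [Wc|nWc] := pselect (W (App c args)).
    apply: (fitting_interp Wc) => [i|].
      have Wi := W_arg i Wc; have [x vx fit] := vfit _ Wi.
      by rewrite (wW _ _ Wi vx).
    have [x vx fit] := vfit _ Wc.
    by rewrite (wW _ _ Wc vx).
  rewrite {2}/w /=; case: pselect => //= _.
  by have [] := nextP (existT _ k (c, fun i => w (args i)))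
    (fun i => wX (args i)).
move=> a _ [phi Phiphi <-]; have Wphi := W_Phi Phiphi.
have [x vx fit] := vfit _ Wphi; rewrite (wW _ _ Wphi vx).
apply: (fitting_dset Wphi fit).
by case: a Phiphi => c /=; [apply: PhiOm | apply: PhinOm].
Qed.

Lemma fitting_choice : exists v : formula Sg -> option M,
  forall phi, W phi -> exists2 x, v phi = Some x & fitting phi x.
Proof.
suff /choice[v vP] : forall phi, exists o : option M,
    W phi -> exists2 x, o = Some x & fitting phi x by exists v.
move=> phi; have [/fitting_ex[x fit]|nW] := pselect (W phi).
  by exists (Some x) => _; exists x.
by exists None.
Qed.

End Countermodel.

(** A Gödel numbering: a compound is coded by its arity, its connective and the codes of its
    arguments. *)
Lemma formula_inj (Sg : nat -> Type) : countable_signature Sg ->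
  exists code : formula Sg -> nat, injective code.
Proof.
move=> Sgc.
have codeP k : exists f : Sg k -> nat, injective f.
  have /countable_injP[f finj] := Sgc k.
  by exists f => x y; apply: finj; rewrite in_setE.
pose f k := sval (cid (codeP k)).
have finj k : injective (f k) by exact: svalP (cid (codeP k)).
pose code := fix code (phi : formula Sg) : nat :=
  match phi with
  | Var i => pickle (inl i : nat + nat * nat * seq nat)
  | App k c args => pickle
      (inr (k, f k c, [seq code (args i) | i <- enum 'I_k])
        : nat + nat * nat * seq nat)
  end%type.
have pinj := pcan_inj (@pickleK (nat + nat * nat * seq nat)%type).
exists code; elim=> [i|k c args IH] [j|k' c' args'] /pinj //.
  by case=> ->.
case=> ek; subst k' => /finj <- /eq_in_map e.
congr App; apply: funext => i; apply: IH.
by apply: e; rewrite mem_enum.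
Qed.

Theorem theorem2 (Sg : nat -> Type) (M : matrix Sg)
    (Theta : M -> statement Sg) :
  discriminator Theta ->
  complete (calc Theta) M /\
  (oriented Theta ->
   countable_signature Sg \/ enough_variables M ->
   analytic (formulas_of Theta) (calc Theta)).
Proof.
move=> discr; split=> [Phi PhiM|orient vars Phi Phiprov].
  have [||t tP _] := @unsaturated_proof _ (calc Theta) Phi setT;
    [by []| |by exists t].
  move=> [Om satOm].
  have [v vP] := @fitting_choice _ _ _ _ setT setT _ satOm
    (fun _ _ _ _ _ _ => I).
  apply: (countermodel satOm _ _ _ _ vP) PhiM => //.
  (* Attained values come from formulas, and the value of the compound of these formulas is the
     output that totality asks for. *)
  exists (attained setT v); split=> //.
  - by have [x vx _] := vP (Var pvar) I; exists x, (Var pvar).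
  - move=> k c xs; have /choice[args argsE] i :
        exists phi, fitting Theta Om phi (sval (xs i)).
      have [phi _ vphi] := svalP (xs i); exists phi => //.
      by have [x vx] := vP phi I; move: vx; rewrite vphi => -[->].
    have [y vy fity] := vP (App c args) I.
    have Xy : attained setT v y by exists (App c args).
    exists (exist _ _ Xy) => /=.
    apply: (fitting_interp (W := setT) satOm _ _ _ _ fity) => //.
(* Soundness makes [Phi] hold, so a countermodel built from a saturated pair is absurd. *)
have PhiM := proof_sound (calc_sound discr orient) Phiprov.
have WU : sub_stmt Phi `<=` gsub (formulas_of Theta) Phi by move=> phi; left.
have WTheta phi x a psi : sub_stmt Phi phi -> Theta x a psi ->
    gsub (formulas_of Theta) Phi (subst (fun=> phi) psi).
  move=> Wphi psiT; right; exists (fun=> phi), psi; split=> //.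
  by exists x => //; exists a.
have WPhi a : Phi a `<=` sub_stmt Phi.
  by move=> phi Pphi; exists a, phi => //; exact: subf_refl.
have Warg k (c : Sg k) args i :
    sub_stmt Phi (App c args) -> sub_stmt Phi (args i).
  by move=> [a [phi Pphi pc]]; exists a, phi => //; exact: subf_arg pc.
apply: (@unsaturated_proof _ (calc Theta) Phi) =>
  [c phi /WPhi /WU //|[Om satOm]].
have [v vP] := fitting_choice satOm WTheta.
apply: (countermodel satOm WPhi Warg WU WTheta vP) PhiM.
(* The contrary assumption is what [enough_variables] asks for. *)
apply: contrapT => nTT; apply: (nTT).
have [ps psinj] : exists ps : M -> nat, forall x y,
    attained (sub_stmt Phi) v x -> attained (sub_stmt Phi) v y ->
    ps x = ps y -> x = y.
  case: vars => [/formula_inj[code codeinj]|/(_ _ nTT)//].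
  have /choice[src srcP] x : exists phi,
      attained (sub_stmt Phi) v x -> v phi = Some x.
    have [[phi _ vphi]|nx] := pselect (attained (sub_stmt Phi) v x).
      by exists phi.
    by exists (Var pvar).
  (* Distinct attained values have distinct source formulas, whose codes serve as variables. *)
  exists (code \o src) => x y vx vy /codeinj e.
  by have := srcP y vy; rewrite -e (srcP x vx) => -[].
apply: (fitting_TT satOm WTheta _ psinj) => phi x Wphi vphi.
by have [y + fit] := vP _ Wphi; rewrite vphi => -[->].
Qed.
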